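(* There exist an integer $r$ and an infinite family of DAGs $G$ with unboundedly many nodes such that $\mathrm{OPT}_{PRBP}(G,r)=O(1)$ but $\mathrm{MIN}_{part}(2r)=\Theta(n)$, where $n$ is the number of nodes of $G$; that is, the smallest $(2r)$-partition of $G$ consists of $\Theta(n)$ classes.
   Context: All DAGs $G=(V,E)$ are finite and have no isolated nodes. Sources are nodes of in-degree 0, sinks are nodes of out-degree 0. An integer $r\ge 1$ (fast memory capacity) is given. Partial-computing red-blue pebble game (PRBP, one-shot). There are blue, light red and dark red pebbles, and edges can be marked. Initially exactly the sources carry blue pebbles, there are no other pebbles, and all edges are unmarked. Moves: (1) Save: replace a dark red pebble on a node by a blue and a light red pebble. (2) Load: place a light red pebble on a node that has a blue pebble. (3) Partial compute: for an unmarked edge $(u,v)$ such that (i) all incoming edges of $u$ are marked, (ii) $u$ has a (light or dark) red pebble, and (iii) $v$ has a (light or dark) red pebble or no pebble at all, replace all pebbles on $v$ by one dark red pebble and mark $(u,v)$ (each edge is marked at most once and never unmarked). (4) Delete: remove a light red pebble from any node, or remove a dark red pebble from a non-sink node all of whose outgoing edges are marked. At every time the total number of (light and dark) red pebbles is at most $r$. A pebbling is a sequence of moves after which every sink has a blue pebble and every edge is marked. Its cost is the total number of save and load moves, and $\mathrm{OPT}_{PRBP}(G,r)$ is the minimum cost of a pebbling of $G$ with capacity $r$. $S$-partitions. For $V_0\subseteq V$, a set $D\subseteq V$ is a dominator for $V_0$ if every directed path that starts at a source and ends in a node of $V_0$ contains a node of $D$ (paths consisting of a single node are included). The terminal set of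 $V_0$ is the set of nodes $v\in V_0$ none of whose out-neighbors lie in $V_0$. For a positive integer $S$, an $S$-partition of $G$ is a partition of $V$ into disjoint classes $V_1,\dots,V_k$ such that: (i) if $u\in V_i$ and $v\in V_j$ with $i>j$, then $(u,v)\notin E$; (ii) each $V_i$ has a dominator of size at most $S$; (iii) the terminal set of each $V_i$ has size at most $S$. $\mathrm{MIN}_{part}(S)$ is the minimum number of classes of any $S$-partition of $G$. *)

(* Defs.v *)
From mathcomp Require Import all_boot all_order all_algebra.

Set Implicit Arguments.
Unset Strict Implicit.
Unset Printing Implicit Defensive.

Definition is_min (P : nat -> Prop) (m : nat) : Prop :=
  P m /\ forall m', P m' -> m <= m'.

(* [cycle e [:: x]] is [e x x], so acyclicity also excludes loops. *)
Record dag := Dag {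
  node :> finType;
  edge : rel node;
  edge_acyclic : forall c : seq node, cycle edge c -> c = [::];
  no_isolated : forall v : node, [exists u, edge u v || edge v u]
}.

Definition source (G : dag) (v : G) : bool := [forall u, ~~ edge u v].
Definition sink (G : dag) (v : G) : bool := [forall w, ~~ edge v w].

(** * One-shot partial-computing red-blue pebble game *)

(* Each field is the set of nodes carrying a pebble of that colour, so a node
   carries at most one pebble per colour: loading a node that already has a
   light red pebble costs 1 and changes nothing. *)
Record state (G : dag) := State {
  blue : {set G};
  light : {set G};
  dark : {set G};
  marked : {set G * G}
}.

Inductive move (G : dag) :=
  | MoveSave of G
  | MoveLoad of G
  | MoveCompute of G & G
  | MoveDeleteLight of G
  | MoveDeleteDark of G.

Definition initial (G : dag) : state G :=
  State [set v : G | source v] set0 set0 set0.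

Definition red (G : dag) (s : state G) : {set G} := light s :|: dark s.

Definition enabled (G : dag) (s : state G) (m : move G) : bool :=
  match m with
  | MoveSave v => v \in dark s
  | MoveLoad v => v \in blue s
  | MoveCompute u v =>
      [&& edge u v, (u, v) \notin marked s,
          [forall w, edge w u ==> ((w, u) \in marked s)],
          u \in red s
        & (v \in red s) || (v \notin blue s :|: red s)]
  | MoveDeleteLight v => v \in light s
  | MoveDeleteDark v =>
      [&& v \in dark s, ~~ sink v
        & [forall w, edge v w ==> ((v, w) \in marked s)]]
  end.

Definition exec (G : dag) (s : state G) (m : move G) : state G :=
  let: State B L D M := s in
  match m with
  | MoveSave v => State (v |: B) (v |: L) (D :\ v) M
  | MoveLoad v => State B (v |: L) D M
  | MoveCompute u v => State (B :\ v) (L :\ v) (v |: D) ((u, v) |: M)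
  | MoveDeleteLight v => State B (L :\ v) D M
  | MoveDeleteDark v => State B L (D :\ v) M
  end.

Fixpoint legal (G : dag) (r : nat) (s : state G) (ms : seq (move G)) : bool :=
  (#|light s| + #|dark s| <= r) &&
  if ms is m :: ms' then enabled s m && legal r (exec s m) ms' else true.

Definition complete (G : dag) (s : state G) : bool :=
  [forall v, sink v ==> (v \in blue s)] &&
  [forall u, forall v, edge u v ==> ((u, v) \in marked s)].

Definition pebbling (G : dag) (r : nat) (ms : seq (move G)) : bool :=
  legal r (initial G) ms && complete (foldl (@exec G) (initial G) ms).

Definition io_move (G : dag) (m : move G) : bool :=
  match m with MoveSave _ | MoveLoad _ => true | _ => false end.

Definition cost (G : dag) (ms : seq (move G)) : nat := count (@io_move G) ms.

Definition is_OPT_PRBP (G : dag) (r : nat) : nat -> Prop :=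
  is_min (fun c => exists2 ms : seq (move G), pebbling r ms & cost ms = c).

(** * S-partitions *)

Definition dominator (G : dag) (D V0 : {set G}) : Prop :=
  forall (s : G) (p : seq G),
    source s -> path (@edge G) s p -> last s p \in V0 ->
    exists2 d, d \in D & d \in s :: p.

Definition terminal (G : dag) (V0 : {set G}) : {set G} :=
  [set v in V0 | [forall w in V0, ~~ edge v w]].

(* The classes are indexed because their order matters. As [partition] speaks
   of the unordered set of classes, injectivity is what makes classes with
   distinct indices disjoint (and k the number of classes). *)
Record S_partition (G : dag) (S k : nat) (V : 'I_k -> {set G}) : Prop := {
  S_part_inj : injective V;
  S_part_partition : partition [set V i | i : 'I_k] [set: G];
  S_part_edge : forall (i j : 'I_k) (u v : G),
    u \in V i -> v \in V j -> j < i -> ~~ edge u v;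
  S_part_dominator : forall i, exists2 D : {set G},
    dominator D (V i) & #|D| <= S;
  S_part_terminal : forall i, #|terminal (V i)| <= S
}.

Definition is_MIN_part (G : dag) (S : nat) : nat -> Prop :=
  is_min (fun k => exists V : 'I_k -> {set G}, S_partition S V).

(* Main.v *)
(* The DAG has K sources x_i; each x_i feeds the n nodes u_ij, and all the u_ij
   feed one common sink v.  With three red pebbles a pebbling loads the x_i one
   after the other, accumulates every u_ij into v at once and never reloads
   anything: the cost is K + 1.  In an S-partition with S < K, the dominator of
   the class of v misses some zone {x_i, u_i1, .., u_in}, so that no u_ij of
   this zone lies in the class of v.  In every other class these u_ij are terminal,
   so at most S of them share a class, and at least n / S classes are needed.
   We take r = 3, S = 6 and K = 7. *)

Require Import Defs.
From mathcomp Require Import all_boot all_order all_algebra.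
From mathcomp Require Import zify.
From Stdlib Require Import Classical_Prop.

Set Implicit Arguments.
Unset Strict Implicit.
Unset Printing Implicit Defensive.

Import GRing.Theory Num.Theory.

(** Descent below [m]. Since [P] need not be decidable, excluded middle decides at each stage
    whether a smaller witness exists. *)
Lemma is_min_exists (P : nat -> Prop) (m : nat) :
  P m -> exists2 m0, is_min P m0 & m0 <= m.
Proof.
have [k] := ubnP m; elim: k m => // k IHk m lt_mk Pm.
have [[m' lt_m'm Pm'] | no_smaller] := classic (exists2 m', m' < m & P m').
  have [|m0 min_m0 le_m0] := IHk m' _ Pm'; first exact: leq_trans lt_m'm _.
  by exists m0 => //; apply: leq_trans le_m0 (ltnW lt_m'm).
exists m => //; split=> // m' Pm'; rewrite leqNgt.
by apply/negP=> lt_m'm; apply: no_smaller; exists m'.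
Qed.

(** * S-partitions *)

Lemma S_partition_classP (G : dag) (S k : nat) (V : 'I_k -> {set G}) (x : G) :
  S_partition S V -> exists i, x \in V i.
Proof.
case=> _ partV _ _ _; have: x \in cover [set V i | i : 'I_k].
  by rewrite (cover_partition partV) inE.
by case/bigcupP=> _ /imsetP[i _ ->] xVi; exists i.
Qed.

(** Singletons listed by nondecreasing [rank] form an S-partition: an edge going back in this list
    would contradict the strict growth of [rank], and each singleton dominates itself. This makes
    the minimum exist and bounds it by the number of nodes. *)
Lemma singleton_S_partition (G : dag) (x0 : G) (rank : G -> nat) (S : nat) :
  (forall u v : G, edge u v -> rank u < rank v) -> 0 < S ->
  exists V : 'I_#|G| -> {set G}, S_partition S V.
Proof.
move=> edge_rank S_gt0.
pose s := sort (relpre rank leq) (enum G).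
have size_s : size s = #|G| by rewrite size_sort cardE.
have uniq_s : uniq s by rewrite sort_uniq enum_uniq.
have sorted_s : sorted (relpre rank leq) s.
  by apply: sort_sorted => x y; apply: leq_total.
have mem_s x : x \in s by rewrite mem_sort mem_enum.
have inj_nth (i j : 'I_#|G|) : nth x0 s i = nth x0 s j -> i = j.
  by move/eqP; rewrite nth_uniq ?size_s // => /eqP/val_inj.
exists (fun i => [set nth x0 s i]); split.
- by move=> i j /set1_inj/inj_nth.
- apply/and3P; split.
  + rewrite eqEsubset subsetT; apply/subsetP=> x _.
    have lt_x : index x s < #|G| by rewrite -size_s index_mem.
    apply/bigcupP; exists [set x]; last exact: set11.
    by apply/imsetP; exists (Ordinal lt_x) => //=; rewrite nth_index.
  + apply/trivIsetP=> _ _ /imsetP[i _ ->] /imsetP[j _ ->] neq_ij.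
    by rewrite disjoints1 inE; apply: contraNneq neq_ij => ->.
  + by apply/imsetP=> -[i _ /setP/(_ (nth x0 s i))]; rewrite !inE eqxx.
- move=> i j u v /set1P-> /set1P-> lt_ji; apply/negP=> /edge_rank.
  rewrite ltnNge => /negP[]; apply: (sorted_leq_nth _ _ x0 sorted_s).
  + by move=> y x z /=; apply: leq_trans.
  + by move=> x /=.
  + by rewrite inE size_s.
  + by rewrite inE size_s.
  + exact: ltnW.
- move=> i; exists [set nth x0 s i]; last by rewrite cards1.
  by move=> x p _ _ /set1P <-; exists (last x p); rewrite ?set11 ?mem_last.
- move=> i; apply: leq_trans S_gt0; rewrite -(cards1 (nth x0 s i)).
  apply/subset_leq_card/subsetP=> x.
  by rewrite [in x \in terminal _]inE => /andP[].
Qed.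

(** * The fan *)

(* [None] is the sink v, [Some (i, None)] is x_i, [Some (i, Some j)] is u_ij. *)
Definition fan_node (K n : nat) : finType :=
  option ('I_K * option 'I_n).

Definition fan_edge (K n : nat) : rel (fan_node K n) := fun a b =>
  match a, b with
  | Some (i, None), Some (i', Some _) => i == i'
  | Some (_, Some _), None => true
  | _, _ => false
  end.

Definition fan_rank (K n : nat) (a : fan_node K n) : nat :=
  match a with None => 2 | Some (_, Some _) => 1 | Some (_, None) => 0 end.

Lemma fan_edge_rank (K n : nat) (a b : fan_node K n) :
  fan_edge a b -> fan_rank a < fan_rank b.
Proof. by case: a b => [[i [j|]]|] [[i' [j'|]]|]. Qed.

(** Ranks grow strictly along edges, so a closed path through [a] would give [a] a rank below
    itself. *)
Lemma fan_acyclic (K n : nat) (c : seq (fan_node K n)) :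
  cycle (@fan_edge K n) c -> c = [::].
Proof.
case: c => //= a p path_p.
have: path (relpre (@fan_rank K n) ltn) a (rcons p a).
  by apply: sub_path path_p; apply: fan_edge_rank.
rewrite path_sortedE; last by move=> y x z /=; apply: ltn_trans.
by rewrite all_rcons /= ltnn.
Qed.

Lemma fan_no_isolated (K n : nat) (a : fan_node K.+1 n.+1) :
  [exists b, fan_edge b a || fan_edge a b].
Proof.
apply/existsP; case: a => [[i [j|]]|]; first by exists None; rewrite orbT.
  by exists (Some (i, Some ord0)); rewrite orbC /= eqxx.
by exists (Some (ord0, Some ord0)).
Qed.

(** Both parameters are shifted by one, which excludes isolated nodes: there are [K.+1] sources with
    [n.+1] successors each. *)
Definition fan (K n : nat) : dag :=
  Dag (@fan_acyclic K.+1 n.+1) (@fan_no_isolated K n).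

Lemma card_fan (K n : nat) : #|fan K n| = (K.+1 * n.+2).+1.
Proof. by rewrite card_option card_prod card_option !card_ord. Qed.

Lemma fan_source (K n : nat) (a : fan K n) : source a = (fan_rank a == 0).
Proof.
case: a => [[i [j|]]|]; apply/forallP => /=.
- by move/(_ (Some (i, None))); rewrite /= eqxx.
- by case=> [[i' [j'|]]|].
- by move/(_ (Some (ord0, Some ord0))).
Qed.

Lemma fan_sink (K n : nat) (a : fan K n) : sink a = (a == None).
Proof.
case: a => [[i [j|]]|]; apply/forallP => /=.
- by move/(_ None).
- by move/(_ (Some (i, Some ord0))); rewrite /= eqxx.
- by case=> [[i' [j'|]]|].
Qed.

Lemma fan_S_partition_lower (K n S k : nat) (V : 'I_k -> {set fan K n}) :
  S <= K -> S_partition S V -> n.+1 <= k * S.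
Proof.
move=> le_SK partV; have [c v_c] := S_partition_classP (None : fan K n) partV.
have [D domD le_DS] := S_part_dominator partV c.
(* The sink has zone [None] and every other node [Some] of its first index. By pigeonhole, at most
   [S < K.+1] nodes of [D] cannot meet all [K.+1] proper zones. *)
pose zone (a : fan K n) := omap fst a.
have [i zone_i] : exists i, Some i \notin zone @: D.
  apply/existsP; rewrite -negb_forall; apply/negP=> /forallP all_zones.
  have: #|[set Some i | i : 'I_K.+1]| <= #|D|.
    apply: leq_trans (leq_imset_card zone D).
    by apply/subset_leq_card/subsetP=> _ /imsetP[i _ ->].
  rewrite card_imset ?card_ord; last exact: Some_inj.
  by apply/negP; rewrite -leqNgt (leq_trans le_DS).
have notD a : zone a = Some i -> a \notin D.
  move=> za; apply: contra zone_i => aD.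
  by rewrite -za imset_f.
pose u j : fan K n := Some (i, Some j).
(* Otherwise the path from [x_i] to [u j], which stays inside the missed zone, would have to meet
   [D]. *)
have u_notin_c j : u j \notin V c.
  apply/negP=> uc; have [||d dD] := domD (Some (i, None)) [:: u j] _ _ uc.
  - by rewrite fan_source.
  - by rewrite /= eqxx.
  by rewrite !inE => /orP[] /eqP dE; have := notD d; rewrite dD dE => /(_ erefl).
have cover_u : [set: 'I_n.+1] \subset \bigcup_(m : 'I_k) [set j | u j \in V m].
  apply/subsetP=> j _; have [m um] := S_partition_classP (u j) partV.
  by apply/bigcupP; exists m; rewrite // inE.
(* Union bound over the [k] classes: it remains to show that each contains at most [S] of the
   [u j]. *)
have := subset_leq_card cover_u; rewrite cardsT card_ord => /leq_trans-> //.
rewrite -[k in k * S]card_ord -sum_nat_const.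
apply: (big_ind2 (fun (A : {set _}) a => #|A| <= a)) => [|A a B b leA leB|m _].
- by rewrite cards0.
- by rewrite (leq_trans (leq_card_setU A B).1) ?leq_add.
have inj_u : injective u by move=> j j' [].
apply: leq_trans (S_part_terminal partV m); rewrite -(card_imset _ inj_u).
(* The only out-neighbor of [u j] is the sink. Were it in [V m], disjointness would force
   [V m = V c], which contains no [u j]. *)
apply/subset_leq_card/subsetP=> _ /imsetP[j + ->]; rewrite !inE => um.
rewrite um; apply/forall_inP=> -[[i' [j'|]]|] //= vm.
have Vcm : V c = V m.
  have /and3P[_ /trivIsetP triv _] := S_part_partition partV.
  apply/eqP/negPn/negP=> /(triv _ _ (imset_f _ _) (imset_f _ _)) disj.
  by have /pred0P/(_ None) := disj isT isT; rewrite /= v_c vm.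
by have := u_notin_c j; rewrite Vcm um.
Qed.

(** * Pebbling the fan *)

Definition reach (G : dag) (r c : nat) (s s' : state G) : Prop :=
  exists ms : seq (move G),
    [/\ legal r s ms, foldl (@exec G) s ms = s' & cost ms = c].

Lemma legal_cat (G : dag) (r : nat) (s : state G) (ms1 ms2 : seq (move G)) :
  legal r s ms1 -> legal r (foldl (@exec G) s ms1) ms2 -> legal r s (ms1 ++ ms2).
Proof.
elim: ms1 s => //= m ms1 IH s /and3P[-> -> leg1] leg2 /=.
exact: IH leg1 leg2.
Qed.

Lemma reach_trans (G : dag) (r c1 c2 : nat) (s1 s2 s3 : state G) :
  reach r c1 s1 s2 -> reach r c2 s2 s3 -> reach r (c1 + c2) s1 s3.
Proof.
case=> [ms1 [leg1 <- <-]] [ms2 [leg2 <- <-]]; exists (ms1 ++ ms2).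
by rewrite foldl_cat /cost count_cat legal_cat.
Qed.

(* The nodes u_ij with (i, j) in A have been computed, accumulated into the
   sink and deleted; in particular the sink has a pebble as soon as A is not
   empty. *)
Definition fan_state (K n : nat) (L : {set fan K n})
    (A : seq ('I_K.+1 * 'I_n.+1)) : state (fan K n) :=
  State [set a : fan K n | source a] L [set a | (a == None) && (A != [::])]
    [set e : fan K n * fan K n | edge e.1 e.2 &&
       match e with
       | (Some (i, Some j), _) | (_, Some (i, Some j)) => (i, j) \in A
       | _ => false
       end].

Lemma fan_dark_le1 (K n : nat) (L : {set fan K n})
    (A : seq ('I_K.+1 * 'I_n.+1)) : #|dark (fan_state L A)| <= 1.
Proof.
rewrite -(cards1 (None : fan K n)).
by apply/subset_leq_card/subsetP=> a; rewrite !inE => /andP[].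
Qed.

(** The capacity 3 is what the peak needs: a light pebble on [x_i] and dark ones on [u_ij] and the
    sink. Marking the single out-edge of [u_ij] then frees its pebble without any I/O. *)
Lemma fan_reach_leaf (K n : nat) (i : 'I_K.+1) (j : 'I_n.+1)
    (A : seq ('I_K.+1 * 'I_n.+1)) :
  (i, j) \notin A ->
  reach 3 0 (fan_state [set Some (i, None)] A)
            (fan_state [set Some (i, None)] ((i, j) :: A)).
Proof.
move=> ijA; pose x : fan K n := Some (i, None).
pose u : fan K n := Some (i, Some j); pose v : fan K n := None.
pose B := [set a : fan K n | source a]; pose D := dark (fan_state [set x] A).
have notinD1 (C : {set fan K n}) a : a \notin C -> C :\ a = C.
  by move=> aC; apply/setDidPl; rewrite disjoint_sym disjoints1.
have ux : (u == x) = false by apply/eqP.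
have Bu : B :\ u = B by rewrite notinD1 // inE fan_source.
have Bv : B :\ v = B by rewrite notinD1 // inE fan_source.
have xu : [set x] :\ u = [set x] by rewrite notinD1 // inE ux.
have xv : [set x] :\ v = [set x] by rewrite notinD1 // inE; apply/eqP.
have Du : #|u |: D| <= 2.
  apply: leq_trans (leq_card_setU _ _).1 _.
  by rewrite cards1 ltnS fan_dark_le1.
have Dv : v |: (u |: D) = [set v; u].
  by apply/setP=> a; rewrite !inE; case: (a == v); case: (a == u).
have Dd : [set v; u] :\ u = [set v].
  by apply/setP=> a; rewrite !inE; case: (a =P u) => [->|_]; rewrite ?orbF.
exists [:: MoveCompute x u; MoveCompute u v; MoveDeleteDark u]; split=> //.
- rewrite /= -/D -/B Bu xu xv Dv Dd !cards1 cards2 /=.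
  rewrite (leq_add2l 1 _ 2) (leq_trans (fan_dark_le1 _ _)) //=.
  rewrite (leq_add2l 1 _ 2) Du /= andbT; apply/and3P; split.
  + apply/and5P; split; first exact: eqxx.
    * by rewrite inE negb_and ijA orbT.
    * by apply/forallP=> -[[i' [j'|]]|].
    * by rewrite !inE eqxx.
    * by rewrite orbC !inE fan_source /= ux.
  + apply/and4P; split.
    * by rewrite !inE negb_or negb_and ijA orbT andbT -pair_eqE /= andbF.
    * apply/forallP=> -[[i' [j'|]]|] //; apply/implyP=> /= /eqP->.
      by rewrite !inE eqxx.
    * by rewrite !inE eqxx orbT.
    * by rewrite !inE fan_source /=; case: (A != [::]).
  + rewrite fan_sink; apply/and3P; split=> //; first by rewrite !inE eqxx orbT.
    by apply/forallP=> -[w|] //; rewrite !inE eqxx.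
rewrite /= -/D -/B Bu Bv xu xv Dv Dd; congr State; apply/setP.
  by move=> a; rewrite !inE andbT.
have SomeE (T : eqType) (a b : T) : (Some a == Some b) = (a == b) by [].
case=> -[[i1 [j1|]]|] [[i2 [j2|]]|]; rewrite !inE /= /x /u /v ?xpair_eqE.
all: rewrite ?SomeE ?xpair_eqE ?SomeE ?eqxx ?andbF ?andbT ?orbF //=.
(* The remaining case is that of an edge from a source to some [u_ij]. *)
by case: (i2 =P i) => [->|]; rewrite ?andbF //; case: (i1 == i).
Qed.

Lemma fan_reach_leaves (K n : nat) (i : 'I_K.+1) (js : seq 'I_n.+1)
    (A : seq ('I_K.+1 * 'I_n.+1)) :
  uniq (map (pair i) js ++ A) ->
  reach 3 0 (fan_state [set Some (i, None)] A)
            (fan_state [set Some (i, None)] (map (pair i) js ++ A)).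
Proof.
elim: js => [_|j js IH /= /andP[ijA uniqA]].
  exists [::]; split=> //=; rewrite andbT cards1.
  exact: leq_trans (fan_dark_le1 [set Some (i, None)] A) _.
exact: (reach_trans (IH uniqA) (fan_reach_leaf ijA)).
Qed.

(** Each zone costs one load: its source keeps the light pebble until all its successors are
    processed, and then gives it up to make room for the next source. *)
Lemma fan_reach_zones (K n : nat) (si : seq 'I_K.+1) :
  uniq si ->
  reach 3 (size si) (initial (fan K n))
    (fan_state set0 [seq (i, j) | i <- si, j <- enum 'I_n.+1]).
Proof.
elim: si => [_|i si IH /= /andP[i_si uniq_si]].
  exists [::]; split=> //=; first by rewrite !cards0.
  congr State; apply/setP=> a; rewrite !inE ?andbF //.
  by case: a => [[[i [j|]]|] [[i' [j'|]]|]]; rewrite ?andbF.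
rewrite -[(size si).+1]addn1; apply: (reach_trans (IH uniq_si)).
set A := [seq (i', j) | i' <- si, j <- _].
have dark_le1 := fan_dark_le1 set0 A.
have load : reach 3 1 (fan_state set0 A) (fan_state [set Some (i, None)] A).
  exists [:: MoveLoad (Some (i, None) : fan K n)]; split=> //=.
    rewrite inE fan_source /= setU0 cards0 cards1.
    by rewrite (leq_trans dark_le1) // (leq_add2l 1 _ 2) (leq_trans dark_le1).
  by rewrite /fan_state setU0.
have unload (B : seq ('I_K.+1 * 'I_n.+1)) :
    reach 3 0 (fan_state [set Some (i, None)] B) (fan_state set0 B).
  have dark_leB := fan_dark_le1 set0 B.
  exists [:: MoveDeleteLight (Some (i, None) : fan K n)]; split=> //=.
    rewrite set11 setDv cards0 cards1.
    by rewrite (leq_add2l 1 _ 2) !(leq_trans dark_leB).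
  by rewrite /fan_state setDv.
apply: (reach_trans load (reach_trans (fan_reach_leaves _) (unload _))).
(* The pairs must be distinct because an edge can be marked only once; those of zone [i] are new
   because [i] is not in [si]. *)
rewrite cat_uniq map_inj_uniq ?enum_uniq /=; last by move=> j j' [].
rewrite allpairs_uniq ?enum_uniq ?andbT //; last by move=> [? ?] [? ?] _ _ [-> ->].
apply/hasPn=> _ /allpairsP[[i' j'] [/= i'_si _ ->]].
by apply: contra i_si => /mapP[j _ [<- _]].
Qed.

Lemma fan_pebbling (K n : nat) :
  exists2 ms : seq (move (fan K n)), pebbling 3 ms & cost ms = K.+2.
Proof.
have [ms [leg]] := fan_reach_zones n (enum_uniq 'I_K.+1).
set A := [seq _ | i <- _, j <- _] => end_ms cost_ms.
have memA i j : (i, j) \in A by rewrite allpairs_f ?mem_enum.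
pose save : seq (move (fan K n)) := [:: MoveSave (None : fan K n)].
exists (ms ++ save); last first.
  by rewrite /cost count_cat -/(cost ms) cost_ms -cardE card_ord addn1.
(* Nonemptiness of [A] puts a dark pebble on the sink, so the final save is enabled. *)
have A_nil : A != [::] by apply: contraTneq (memA ord0 ord0) => ->.
rewrite /pebbling legal_cat ?end_ms //=; last first.
  have -> : [set a : fan K n | (a == None) && (A != [::])] = [set None].
    by apply/setP=> a; rewrite !inE A_nil andbT.
  by rewrite set11 setU0 setDv cards0 !cards1.
rewrite foldl_cat end_ms /=; apply/andP; split.
  by apply/forallP=> a; rewrite fan_sink !inE; case: eqP.
apply/forallP=> a; apply/forallP=> b; rewrite !inE /=.
by case: a b => [[i [j|]]|] [[i' [j'|]]|] //=; rewrite memA andbT implybb.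
Qed.

Theorem lemma5p4 :
  exists (r : nat) (G : nat -> dag),
    [/\ 1 <= r,
        forall N : nat, exists k : nat, N < #|node (G k)|,
        exists C : nat, forall k : nat,
          exists2 c : nat, is_OPT_PRBP (G k) r c & c <= C
      & exists a b : rat, [/\ (0 < a)%R, (0 < b)%R &
          forall k : nat, exists2 p : nat, is_MIN_part (G k) (2 * r) p &
            (a * #|node (G k)|%:R <= p%:R <= b * #|node (G k)|%:R)%R]].
Proof.
exists 3, (fan 6); split; first by [].
- by move=> N; exists N; rewrite card_fan; lia.
(* Seven loads and one save. *)
- exists 8 => k; have [ms ms_ok cost_ms] := fan_pebbling 6 k.
  by apply: is_min_exists; exists ms.
(* With [k.+1 <= 6 * p], the number of nodes is [7 * k + 15 <= 15 * k.+1 <= 90 * p]. *)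
exists (90%:R^-1)%R, 1%R.
split; [by rewrite invr_gt0 ltr0n | exact: ltr01 | move=> k].
have [V partV] : exists V : 'I_#|fan 6 k| -> {set fan 6 k}, S_partition (2 * 3) V.
  apply: (@singleton_S_partition (fan 6 k) None (@fan_rank 7 k.+1)).
    exact: fan_edge_rank.
  by [].
have [p min_p le_p] :
    exists2 p, is_MIN_part (fan 6 k) (2 * 3) p & p <= #|fan 6 k|.
  by apply: is_min_exists; exists V.
exists p => //; have [[W partW] _] := min_p.
have lower : k.+1 <= p * 6 := fan_S_partition_lower (leqnn 6) partW.
rewrite mul1r; apply/andP; split; last by rewrite ler_nat.
rewrite mulrC ler_pdivrMr ?ltr0n // -natrM ler_nat card_fan.
lia.
Qed.
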